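(* For all $\ell,n\in\mathbb{N}^+$ there exists an $(\ell,n,1)$-Static Ranker that uses $\mathcal{B}(1+o(1))$ bits of memory, where $\mathcal{B}=n\log_2(\ell+1)$ and $o(1)$ denotes a quantity tending to $0$ as $n\to\infty$.
   Context: Model: word RAM with word size $\Theta(\log n+\log \ell)$. For a value $V$ and $\epsilon>0$, $\widehat V$ is an $\epsilon$-additive approximation of $V$ if $V-\epsilon<\widehat V\le V$. For $\ell,n,\Delta\in\mathbb{N}^+$, an $(\ell,n,\Delta)$-Static Ranker is a data structure that preprocesses a sequence $x=(x_1,\dots,x_n)\in\{0,1,\dots,\ell\}^n$ and, when queried with any $i\le n$, returns in $O(1)$ time a $\Delta$-additive approximation $\widehat{S_i}$ of $S_i=\sum_{d=1}^i x_d$. With $\Delta=1$ this means $S_i-1<\widehat{S_i}\le S_i$. The memory is the number of bits of the stored structure. *)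

(* Defs.v *)
From mathcomp Require Export all_boot all_order all_algebra.
From mathcomp Require Export boolp classical_sets reals topology normedtype
  sequences exp.

Set Implicit Arguments.
Unset Strict Implicit.
Unset Printing Implicit Defensive.

Import Order.TTheory GRing.Theory Num.Theory.

(* Word RAM.  A machine of word size w computes on naturals below 2 ^ w.  It has
   word registers, of which a program mentions finitely many, and a memory of
   words that a query can only read: the stored structure survives any number
   of queries, and all working space is the O(1) registers of the program. *)

Inductive binop :=
  | OpAdd | OpSub | OpMul | OpDiv | OpMod
  | OpAnd | OpOr | OpXor | OpShl | OpShr
  | OpLt | OpEq.

Definition eval_binop (w : nat) (op : binop) (a b : nat) : nat :=
  (match op with
   | OpAdd => a + b
   | OpSub => a + (2 ^ w - b)
   | OpMul => a * b
   | OpDiv => a %/ b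
   | OpMod => a %% b
   | OpAnd => Nat.land a b
   | OpOr => Nat.lor a b
   | OpXor => Nat.lxor a b
   | OpShl => a * 2 ^ b
   | OpShr => a %/ 2 ^ b
   | OpLt => nat_of_bool (a < b)
   | OpEq => nat_of_bool (a == b)
   end %% 2 ^ w)%N.

Inductive instr :=
  | Const of nat & nat               (* reg[r] := k mod 2^w *)
  | Binop of binop & nat & nat & nat (* reg[r] := reg[r1] op reg[r2] *)
  | ReadMem of nat & nat             (* reg[r] := mem[reg[a]] *)
  | JumpZ of nat & nat               (* if reg[r] = 0 go to instruction t *)
  | Halt.                            (* stop with output reg[0] *)

Definition program := seq instr.

Definition set_reg (regs : nat -> nat) (r v : nat) : nat -> nat :=
  fun s => if s == r then v else regs s.

(* [run w P mem t pc regs] is [Some v] iff the execution of P starting at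
   instruction pc halts with output v after at most t instructions; leaving the
   program or reading outside the stored memory is a fault. *)
Fixpoint run (w : nat) (P : program) (mem : seq nat) (t pc : nat)
    (regs : nat -> nat) : option nat :=
  if t is t'.+1 then
    match onth P pc with
    | Some (Const r k) =>
        run w P mem t' pc.+1 (set_reg regs r (k %% 2 ^ w)%N)
    | Some (Binop op r r1 r2) =>
        run w P mem t' pc.+1
          (set_reg regs r (eval_binop w op (regs r1) (regs r2)))
    | Some (ReadMem r a) =>
        if onth mem (regs a) is Some v then
          run w P mem t' pc.+1 (set_reg regs r v)
        else None
    | Some (JumpZ r target) =>
        run w P mem t' (if regs r == 0%N then target else pc.+1) regs
    | Some Halt => Some (regs 0%N)
    | None => None
    end
  else None.

(* The query is passed in register 0; all other registers start at 0. *)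
Definition query (w : nat) (P : program) (mem : seq nat) (t i : nat) :
    option nat :=
  run w P mem t 0 (set_reg (fun=> 0%N) 0 (i %% 2 ^ w)%N).

Definition additive_approx (K : numDomainType) (eps v vhat : K) : Prop :=
  (v - eps < vhat <= v)%R.

Definition prefix_sum (l n : nat) (x : n.-tuple 'I_l.+1) (i : nat) : nat :=
  (\sum_(d < n | d < i) tnth x d)%N.

(* An (l, n, Delta)-Static Ranker on a machine of word size w, whose queries are
   answered by the program P within T instructions.  That the query time is O(1)
   is expressed by choosing P and T before l and n.  The preprocessing is
   an arbitrary function; only its output is stored.  Answers are integers,
   which is no loss: as Delta and the prefix sums are integers, a real
   approximation can be rounded up. *)
Record static_ranker (w l n Delta : nat) (P : program) (T : nat) := StaticRanker {
  preprocess : n.-tuple 'I_l.+1 -> seq nat;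
  preprocess_words : forall x, all (fun v => v < 2 ^ w)%N (preprocess x);
  query_correct : forall (x : n.-tuple 'I_l.+1) (i : nat), (i <= n)%N ->
    exists s : nat, query w P (preprocess x) T i = Some s /\
      additive_approx Delta%:Z (prefix_sum x i)%:Z s%:Z
}.

Definition memory_bits (w l n Delta : nat) (P : program) (T : nat)
    (D : static_ranker w l n Delta P T) (x : n.-tuple 'I_l.+1) : nat :=
  (w * size (preprocess D x))%N.

Definition log2 (R : realType) (x : R) : R := (ln x / ln 2)%R.

(* W l n is in Theta(log n + log l), with lower constant c0.  The "+ 1" only
   matters when n = l = 1, where log n + log l vanishes. *)
Definition theta_word_size (R : realType) (c0 : R) (W : nat -> nat -> nat) :
    Prop :=
  (forall l n : nat, (0 < l)%N -> (0 < n)%N ->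
     (c0 * (log2 n%:R + log2 l%:R + 1) <= (W l n)%:R)%R) /\
  (exists c1 : R, forall l n : nat, (0 < l)%N -> (0 < n)%N ->
     ((W l n)%:R <= c1 * (log2 n%:R + log2 l%:R + 1))%R).

(* Main.v *)
Require Import Defs.
From mathcomp Require Import zify lra.
Import Order.TTheory GRing.Theory Num.Theory.
Import numFieldNormedType.Exports.

Set Implicit Arguments.
Unset Strict Implicit.
Unset Printing Implicit Defensive.

(** With Delta = 1 the prefix sums must be exact.  Cut the sequence into blocks
    of b items, and the blocks into superblocks of s.  Store the prefix sum at
    the start of each superblock in a word of its own.  For each block, store in
    one bit field the prefix sum relative to the superblock together with the
    first b - 1 items, written in base l + 1; the fields are packed across word
    boundaries.  A table indexed by block contents answers queries inside a
    block.

    A field takes log2 (s b (l + 1)^b) + O(1) bits, since the relative prefix sum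
    costs only log2 (s b) bits more than the omitted last item: this is
    b log2 (l + 1) + log2 (s b) + O(1).  Let s = (log n)^2, and let b be about
    (log n) / (2 log (l + 1)), rounded up.  Then the table has at most
    n^(1/2) log n words, b log2 (l + 1) is at least (log n) / 4, and the overhead
    O(log log n) per field is negligible.  For large l this choice gives b = 1
    and the table is trivial, so the same structure and the same query program
    serve all l and n. *)

(** * Digit expansions and words *)

Lemma digit_expansionK (B J k : nat) (d : nat -> nat) :
  (forall j, d j < B) -> k < J ->
  (\sum_(j < J) d j * B ^ j) %/ B ^ k %% B = d k.
Proof.
elim: J k d => [//|J IH] k d dB kJ.
have B0 : 0 < B by apply: leq_trans (dB 0).
have -> : \sum_(j < J.+1) d j * B ^ j =
          d 0 + (\sum_(j < J) d j.+1 * B ^ j) * B.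
  rewrite big_ord_recl /= expn0 muln1 big_distrl /=; congr (_ + _).
  by apply: eq_bigr => j _; rewrite /bump /= add1n expnSr mulnA.
case: k kJ => [|k] kJ.
  by rewrite expn0 divn1 addnC modnMDl modn_small.
rewrite expnS divnMA addnC divnMDl // (divn_small (dB 0)) addn0.
by rewrite (IH k (fun j => d j.+1)).
Qed.

Lemma digit_expansion_bound (B J : nat) (d : nat -> nat) :
  (forall j, d j < B) -> \sum_(j < J) d j * B ^ j < B ^ J.
Proof.
move=> dB; elim: J => [|J IH]; first by rewrite big_ord0.
rewrite big_ord_recr /= expnS; apply: (@leq_trans ((d J).+1 * B ^ J)).
  by rewrite mulSn -addSn leq_add2r.
by rewrite leq_mul2r dB orbT.
Qed.

(** Two consecutive words, shifted right and left, give the [w] bits of [A] from position [o] on.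
    The two pieces occupy disjoint bit ranges, so their sum does not overflow. For [o = 0] the
    reduction modulo [2 ^ w] erases the high word. *)
Lemma shifted_word (w A o : nat) : o <= w ->
  A %% 2 ^ w %/ 2 ^ o + ((A %/ 2 ^ w %% 2 ^ w) * 2 ^ (w - o)) %% 2 ^ w =
  A %/ 2 ^ o %% 2 ^ w.
Proof.
move=> ow.
have E : 2 ^ w = 2 ^ (w - o) * 2 ^ o by rewrite -expnD subnK.
have p0 k : 0 < 2 ^ k by rewrite expn_gt0.
rewrite modnMml; set hi := A %/ 2 ^ w; set lo := A %% 2 ^ w.
have -> : A %/ 2 ^ o = hi * 2 ^ (w - o) + lo %/ 2 ^ o.
  by rewrite [A in LHS](divn_eq A (2 ^ w)) -/hi -/lo E mulnA divnMDl //.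
have lob : lo %/ 2 ^ o < 2 ^ (w - o) by rewrite ltn_divLR // -E ltn_pmod.
have hib : (hi * 2 ^ (w - o)) %% 2 ^ w = (hi %% 2 ^ o) * 2 ^ (w - o).
  by rewrite E [2 ^ _ * 2 ^ o]mulnC muln_modl.
rewrite -modnDml hib [RHS]modn_small; first by rewrite addnC.
have := ltn_pmod hi (p0 o); rewrite E; nia.
Qed.

Lemma onth_some (T : Type) (x0 : T) (s : seq T) (k : nat) :
  k < size s -> onth s k = Some (nth x0 s k).
Proof.
rewrite -onthTE; have := odflt_onth x0 s k.
by case: (onth s k) => //= a ->.
Qed.

Lemma onth_mkseq (T : Type) (f : nat -> T) (n k : nat) :
  k < n -> onth (mkseq f n) k = Some (f k).
Proof. by move=> kn; rewrite (onth_some (f 0)) ?size_mkseq // nth_mkseq. Qed.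

Lemma onth_catr (T : Type) (s1 s2 : seq T) (i k : nat) :
  size s1 = k -> onth (s1 ++ s2) (i + k) = onth s2 i.
Proof. by move=> <-; rewrite onth_cat ltnNge leq_addl addnK. Qed.

(** * Prefix sums and the memory layout *)

Definition psum (xs : nat -> nat) (i : nat) : nat := \sum_(d < i) xs d.

Lemma psumD (xs : nat -> nat) (a r : nat) :
  psum xs (a + r) = psum xs a + \sum_(j < r) xs (a + j).
Proof. by rewrite /psum big_split_ord. Qed.

Lemma leq_psum (xs : nat -> nat) (l i : nat) :
  (forall d, xs d <= l) -> psum xs i <= i * l.
Proof.
move=> xl; rewrite /psum; elim: i => [|i IH]; first by rewrite big_ord0.
by rewrite big_ord_recr /= mulSn addnC leq_add.
Qed.

Definition digit_psum (B c r : nat) : nat := \sum_(j < r) c %/ B ^ j %% B.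

Definition block_code (l b : nat) (xs : nat -> nat) (k : nat) : nat :=
  \sum_(j < b.-1) xs (k * b + j) * l.+1 ^ j.

(* The last item of a block is not encoded: it only matters from the next block
   on, whose own relative prefix sum accounts for it. *)
Definition block_field (l b s : nat) (xs : nat -> nat) (k : nat) : nat :=
  (psum xs (k * b) - psum xs (k %/ s * s * b)) * l.+1 ^ b.-1
  + block_code l b xs k.

(** The fields are the digits of one number in base [2 ^ v], and the stored words are its digits in
    base [2 ^ w]: packing across word boundaries is a change of base. Block [n %/ b] has a field
    even when it is empty, since the query [i = n] then lands there. *)
Definition packed_fields (l n b s v : nat) (xs : nat -> nat) : nat :=
  \sum_(k < (n %/ b).+1) block_field l b s xs k * (2 ^ v) ^ k.

Definition packed_size (w n b v : nat) : nat := ((n %/ b).+1 * v %/ w).+2.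
Arguments packed_size : simpl never.
Definition super_size (n b s : nat) : nat := (n %/ b %/ s).+1.
Arguments super_size : simpl never.
Definition table_size (l b : nat) : nat := l.+1 ^ b.-1 * b.
Arguments table_size : simpl never.

(* The packed words begin at address 8.  One word more than needed is stored, so
   that the query may read two consecutive words for every field. *)
Definition ranker_memory (w l n b s v : nat) (xs : nat -> nat) : seq nat :=
  [:: b; s; v; w; 2 ^ v; l.+1 ^ b.-1; 8 + packed_size w n b v;
      8 + packed_size w n b v + super_size n b s]
  ++ mkseq (fun j => packed_fields l n b s v xs %/ 2 ^ (w * j) %% 2 ^ w)
           (packed_size w n b v)
  ++ mkseq (fun t => psum xs (t * s * b)) (super_size n b s)
  ++ mkseq (fun a => digit_psum l.+1 (a %/ b) (a %% b)) (table_size l b).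

Definition ranker_size (w l n b s v : nat) : nat :=
  8 + packed_size w n b v + super_size n b s + table_size l b.

Lemma size_ranker_memory (w l n b s v : nat) (xs : nat -> nat) :
  size (ranker_memory w l n b s v xs) = ranker_size w l n b s v.
Proof. by rewrite /ranker_memory !size_cat !size_mkseq /ranker_size !addnA. Qed.

Lemma block_code_bound (l b : nat) (xs : nat -> nat) (k : nat) :
  (forall d, xs d <= l) -> block_code l b xs k < l.+1 ^ b.-1.
Proof.
move=> xl.
apply: (@digit_expansion_bound _ _ (fun j => xs (k * b + j))) => j.
by rewrite ltnS.
Qed.

Lemma digit_psum_block_code (l b : nat) (xs : nat -> nat) (k r : nat) :
  (forall d, xs d <= l) -> r < b ->
  digit_psum l.+1 (block_code l b xs k) r = \sum_(j < r) xs (k * b + j).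
Proof.
move=> xl rb; apply: eq_bigr => j _.
rewrite /block_code (@digit_expansionK _ _ _ (fun j => xs (k * b + j))).
- by [].
- by move=> i; rewrite ltnS.
by rewrite (leq_trans (ltn_ord j)) // -ltnS (ltn_predK rb).
Qed.

Lemma block_field_bound (l b s v : nat) (xs : nat -> nat) (k : nat) :
  (forall d, xs d <= l) -> 0 < b -> 0 < s -> s * b * l.+1 ^ b <= 2 ^ v ->
  block_field l b s xs k < 2 ^ v.
Proof.
move=> xl b0 s0; apply: leq_trans.
(* The factor [l.+1] here takes the place of the digit of the omitted last item, which gives the
   exponent [b] in place of [b.-1]. *)
have rel : psum xs (k * b) - psum xs (k %/ s * s * b) < s * b * l.+1.
  have -> : k * b = k %/ s * s * b + k %% s * b by rewrite -mulnDl -divn_eq.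
  rewrite psumD addKn.
  have := leq_psum (k %% s * b) (fun d => xl (k %/ s * s * b + d)).
  rewrite /psum; have := ltn_pmod k s0; nia.
have := block_code_bound b k xl; rewrite /block_field.
have -> : l.+1 ^ b = l.+1 * l.+1 ^ b.-1 by rewrite -expnS prednK.
nia.
Qed.

Lemma ranker_memory_words (w l n b s v : nat) (xs : nat -> nat) :
  (forall d, xs d <= l) -> 0 < b <= n -> 0 < s < 2 ^ w -> v < w ->
  n < 2 ^ w -> n * l < 2 ^ w -> ranker_size w l n b s v < 2 ^ w ->
  all (fun a => a < 2 ^ w) (ranker_memory w l n b s v xs).
Proof.
move=> xl /andP[b0 bn] /andP[s0 sw] vw nw nlw.
rewrite /ranker_size => szw.
have w2 := ltn_expl w (ltnSn 1).
(* The header entry [l.+1 ^ b.-1] fits in a word because the table is at least that long. *)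
have Cb : l.+1 ^ b.-1 <= table_size l b by rewrite leq_pmulr.
rewrite /ranker_memory !all_cat; apply/and4P; split.
- by rewrite /= w2 ltn_exp2l // vw; do !(apply/andP; split); lia.
- apply/allP => a /mapP[j]; rewrite mem_iota add0n /= => jlt ->.
  by rewrite ltn_pmod // expn_gt0.
- apply/allP => a /mapP[j]; rewrite mem_iota add0n /= => jlt ->.
  apply: leq_ltn_trans nlw; apply: leq_trans (leq_psum _ xl) _.
  rewrite leq_mul2r; apply/orP; right.
  by rewrite -!leq_divRL.
- apply/allP => a /mapP[j]; rewrite mem_iota add0n /= => jlt ->.
  apply: leq_ltn_trans nlw; apply: (@leq_trans (j %% b * l)).
    apply: (@leq_psum (fun i => j %/ b %/ l.+1 ^ i %% l.+1)) => d.
    by rewrite -ltnS ltn_pmod.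
  by rewrite leq_mul2r (leq_trans _ bn) ?orbT // ltnW // ltn_pmod.
Qed.

Lemma table_index_bound (l b c r : nat) :
  c < l.+1 ^ b.-1 -> r < b -> c * b + r < table_size l b.
Proof.
move=> cC rb; apply: (@leq_trans (c.+1 * b)); last by rewrite leq_mul2r cC orbT.
by rewrite mulSn addnC ltn_add2r.
Qed.

Lemma ranker_memory_packed (w l n b s v : nat) (xs : nat -> nat) (j : nat) :
  j < packed_size w n b v ->
  onth (ranker_memory w l n b s v xs) (j + 8) =
  Some (packed_fields l n b s v xs %/ 2 ^ (w * j) %% 2 ^ w).
Proof.
move=> jlt; rewrite /ranker_memory onth_catr // onth_cat size_mkseq jlt.
by rewrite onth_mkseq.
Qed.

Lemma ranker_memory_super (w l n b s v : nat) (xs : nat -> nat) (t : nat) :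
  t < super_size n b s ->
  onth (ranker_memory w l n b s v xs) (t + (8 + packed_size w n b v)) =
  Some (psum xs (t * s * b)).
Proof.
move=> tlt; rewrite [8 + _]addnC addnA /ranker_memory onth_catr //.
by rewrite onth_catr ?size_mkseq // onth_cat size_mkseq tlt onth_mkseq.
Qed.

Lemma ranker_memory_table (w l n b s v : nat) (xs : nat -> nat) (c r : nat) :
  c < l.+1 ^ b.-1 -> r < b ->
  onth (ranker_memory w l n b s v xs)
    (c * b + r + (8 + packed_size w n b v + super_size n b s)) =
  Some (digit_psum l.+1 c r).
Proof.
move=> cC rb; rewrite -[8 + _ + _]addnA [8 + _]addnC.
rewrite [packed_size _ _ _ _ + _]addnC.
rewrite !addnA /ranker_memory onth_catr // !onth_catr ?size_mkseq //.
rewrite onth_mkseq ?table_index_bound // divnMDl ?(leq_trans _ rb) //.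
by rewrite modnMDl (divn_small rb) modn_small // addn0.
Qed.

(** Field [k] starts at bit [k * v], that is, at bit [o] of word [j]. As [v < w], the [w] bits from
    there on contain the whole field, and reduction modulo [2 ^ v] removes the fields above it. *)
Lemma packed_fieldsK (w l n b s v : nat) (xs : nat -> nat) (k : nat) :
  (forall d, xs d <= l) -> 0 < b -> 0 < s -> s * b * l.+1 ^ b <= 2 ^ v ->
  v < w -> k <= n %/ b ->
  let Z := packed_fields l n b s v xs in
  let j := k * v %/ w in
  let o := k * v %% w in
  ((Z %/ 2 ^ (w * j) %% 2 ^ w) %/ 2 ^ o
    + (Z %/ 2 ^ (w * j.+1) %% 2 ^ w * 2 ^ (w - o)) %% 2 ^ w) %% 2 ^ v
  = block_field l b s xs k.
Proof.
move=> xl b0 s0 vbig vw kn Z j o.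
have w0 : 0 < w by apply: leq_trans vw.
have ow : o <= w by rewrite ltnW // ltn_pmod.
rewrite mulnS [w + _]addnC expnD divnMA shifted_word // -divnMA -expnD.
have -> : w * j + o = v * k by rewrite [w * _]mulnC -divn_eq mulnC.
rewrite modn_dvdm; last by rewrite dvdn_exp2l // ltnW.
rewrite expnM /Z /packed_fields digit_expansionK //.
by move=> i; apply: block_field_bound.
Qed.

(** * The query program and its correctness *)

(* Registers 1 to 8 receive the header b, s, v, w, 2 ^ v, (l + 1) ^ (b - 1) and
   the addresses of the superblock sums and of the table.  Then 10 and 11 hold
   the block and the position in it, 12 the superblock sum, 16 the bit field
   (glued from the two words at which it may lie), 19 and 20 its two parts. *)
Definition ranker_program : program :=
  [:: Const 1 0; ReadMem 1 1; Const 2 1; ReadMem 2 2;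
      Const 3 2; ReadMem 3 3; Const 4 3; ReadMem 4 4;
      Const 5 4; ReadMem 5 5; Const 6 5; ReadMem 6 6;
      Const 7 6; ReadMem 7 7; Const 8 7; ReadMem 8 8;
      Const 9 8;
      Binop OpDiv 10 0 1;
      Binop OpMod 11 0 1;
      Binop OpDiv 12 10 2;
      Binop OpAdd 12 12 7;
      ReadMem 12 12;
      Binop OpMul 13 10 3;
      Binop OpDiv 14 13 4;
      Binop OpMod 15 13 4;
      Binop OpAdd 14 14 9;
      ReadMem 16 14;
      Const 17 1;
      Binop OpAdd 14 14 17;
      ReadMem 18 14;
      Binop OpShr 16 16 15;
      Binop OpSub 15 4 15;
      Binop OpShl 18 18 15;
      Binop OpAdd 16 16 18;
      Binop OpMod 16 16 5;
      Binop OpDiv 19 16 6;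
      Binop OpMod 20 16 6;
      Binop OpMul 20 20 1;
      Binop OpAdd 20 20 11;
      Binop OpAdd 20 20 8;
      ReadMem 20 20;
      Binop OpAdd 0 12 19;
      Binop OpAdd 0 0 20;
      Halt].

(** One-step rules for symbolic execution. The new register value is supplied in simplified form, so
    that reductions modulo [2 ^ w] do not pile up in the registers. *)
Lemma run_const (w : nat) (P : program) (mem : seq nat) (t pc : nat)
    (regs : nat -> nat) (r k : nat) (z : option nat) :
  onth P pc = Some (Const r k) -> k < 2 ^ w ->
  run w P mem t pc.+1 (set_reg regs r k) = z ->
  run w P mem t.+1 pc regs = z.
Proof. by move=> /= -> kw; rewrite modn_small. Qed.

Lemma run_binop (w : nat) (P : program) (mem : seq nat) (t pc : nat)
    (regs : nat -> nat) (op : binop) (r r1 r2 a : nat) (z : option nat) :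
  onth P pc = Some (Binop op r r1 r2) ->
  eval_binop w op (regs r1) (regs r2) = a ->
  run w P mem t pc.+1 (set_reg regs r a) = z ->
  run w P mem t.+1 pc regs = z.
Proof. by move=> /= -> ->. Qed.

Lemma run_read (w : nat) (P : program) (mem : seq nat) (t pc : nat)
    (regs : nat -> nat) (r a x : nat) (z : option nat) :
  onth P pc = Some (ReadMem r a) -> onth mem (regs a) = Some x ->
  run w P mem t pc.+1 (set_reg regs r x) = z ->
  run w P mem t.+1 pc regs = z.
Proof. by move=> /= -> ->. Qed.

(** The program has no jumps, so 44 is its length and it can be executed symbolically. The size
    hypotheses keep the intermediate values below [2 ^ w]; only the left shift and the subtraction
    rely on wraparound. *)
Lemma query_ranker_program (w l n b s v : nat) (xs : nat -> nat) (i : nat) :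
  (forall d, xs d <= l) -> 0 < b -> 0 < s ->
  s * b * l.+1 ^ b <= 2 ^ v -> v < w -> 8 < 2 ^ w ->
  n < 2 ^ w -> n * l < 2 ^ w -> n %/ b * v < 2 ^ w ->
  ranker_size w l n b s v < 2 ^ w -> i <= n ->
  query w ranker_program (ranker_memory w l n b s v xs) 44 i =
  Some (psum xs i).
Proof.
move=> xl b0 s0 vbig vw w8 nw nlw kvw szw i_n.
set mem := ranker_memory _ _ _ _ _ _ _.
set B := 2 ^ w in w8 nw nlw kvw szw *.
set q := packed_size w n b v; set t := super_size n b s.
have w0 : 0 < w by apply: leq_trans vw.
have wB : w < B by rewrite ltn_expl.
set k := i %/ b; set r := i %% b.
have kn : k <= n %/ b by rewrite leq_div2r.
have kvB : k * v < B by apply: leq_ltn_trans kvw; rewrite leq_mul2r kn orbT.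
have kB : k < B by apply: leq_ltn_trans nw; apply: leq_trans (leq_div i b) i_n.
have rb : r < b by rewrite ltn_pmod.
have rB : r < B by apply: leq_ltn_trans nw; apply: leq_trans (leq_mod i b) i_n.
set j := k * v %/ w; set o := k * v %% w.
have jB : j < B by apply: leq_ltn_trans kvB; apply: leq_div.
have ow : o < w by rewrite ltn_pmod.
(* The spare packed word makes the second read legal even for the last field. *)
have jq : j.+1 < q.
  by rewrite /q /packed_size !ltnS leq_div2r // leq_mul2r (leqW kn) orbT.
have ks : k %/ s < t by rewrite ltnS leq_div2r.
move: szw; rewrite /ranker_size -/q -/t => szw.
set Z := packed_fields l n b s v xs.
set lo := Z %/ 2 ^ (w * j) %% B; set hi := Z %/ 2 ^ (w * j.+1) %% B.
set C := l.+1 ^ b.-1; set c := block_code l b xs k.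
have cC : c < C by apply: block_code_bound.
set rel := psum xs (k * b) - psum xs (k %/ s * s * b).
have crT := table_index_bound cC rb.
have field : (lo %/ 2 ^ o + (hi * 2 ^ (w - o)) %% B) %% 2 ^ v = rel * C + c.
  exact: packed_fieldsK.
have sumB : lo %/ 2 ^ o + (hi * 2 ^ (w - o)) %% B < B.
  rewrite /hi mulnS [w + _]addnC expnD divnMA /lo shifted_word ?(ltnW ow) //.
  by rewrite ltn_pmod // expn_gt0.
have fieldB : rel * C + c < B.
  rewrite -field; apply: (@ltn_trans (2 ^ v)); last by rewrite ltn_exp2l.
  by rewrite ltn_pmod // expn_gt0.
(* Superblock, block and position within the block. The truncated subtraction in [rel] is exact
   because the superblock starts no later than the block. *)
have isum : psum xs i = psum xs (k %/ s * s * b) + rel + digit_psum l.+1 c r.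
  rewrite /c digit_psum_block_code // /rel subnKC; last first.
    rewrite (_ : k * b = k %/ s * s * b + k %% s * b) ?psumD ?leq_addr //.
    by rewrite -mulnDl -divn_eq.
  by rewrite -psumD -divn_eq.
have psumB : psum xs i < B.
  apply: leq_ltn_trans nlw; apply: leq_trans (leq_psum _ xl) _.
  by rewrite leq_mul2r i_n orbT.
have relB : rel < B.
  by apply: leq_ltn_trans psumB; rewrite isum -addnA addnCA leq_addr.
have loB : lo < B by rewrite ltn_pmod ?expn_gt0.
rewrite /query modn_small; last exact: leq_ltn_trans nw.
have small k' : k' <= 8 -> k' < B by move=> k8; apply: leq_ltn_trans w8.
do 8!(apply: run_const; [reflexivity|exact: small|
      apply: run_read; [reflexivity|reflexivity|]]).
apply: run_const; [reflexivity|exact: small|].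
apply: (run_binop (a := k)); [reflexivity|exact: modn_small kB|].
apply: (run_binop (a := r)); [reflexivity|exact: modn_small rB|].
apply: (run_binop (a := k %/ s)); [reflexivity|apply: modn_small|].
  exact: leq_ltn_trans (leq_div _ _) kB.
apply: (run_binop (a := k %/ s + (8 + q))); [reflexivity|apply: modn_small|].
  rewrite addnC (leq_ltn_trans _ szw) // -[_ + table_size _ _]addnA.
  by rewrite leq_add2l (leq_trans (ltnW ks)) ?leq_addr.
apply: run_read; [reflexivity|exact: ranker_memory_super|].
apply: (run_binop (a := k * v)); [reflexivity|exact: modn_small kvB|].
apply: (run_binop (a := j)); [reflexivity|exact: modn_small jB|].
apply: (run_binop (a := o)); [reflexivity|exact: modn_small (ltn_trans ow wB)|].
have j9 : (j + 8).+1 < B.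
  rewrite -addSn addnC (leq_ltn_trans _ szw) // -!addnA.
  by rewrite leq_add2l (leq_trans (ltnW jq)) ?leq_addr.
apply: (run_binop (a := j + 8)); [reflexivity|exact: modn_small (ltnW j9)|].
apply: run_read; [reflexivity|exact: ranker_memory_packed (ltnW jq)|].
apply: run_const; [reflexivity|exact: small|].
apply: (run_binop (a := j.+1 + 8)); [reflexivity| |].
  by rewrite /eval_binop [X in X %% _]addn1 modn_small.
apply: run_read; [reflexivity|exact: ranker_memory_packed jq|].
apply: (run_binop (a := lo %/ 2 ^ o)); [reflexivity|apply: modn_small|].
  exact: leq_ltn_trans (leq_div _ _) loB.
apply: (run_binop (a := w - o)); [reflexivity| |].
  change ((w + (B - o)) %% B = w - o).
  rewrite addnBCA ?(ltnW ow) //; last exact: ltnW (ltn_trans ow wB).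
  by rewrite modnDl modn_small // (leq_ltn_trans (leq_subr _ _) wB).
apply: (run_binop (a := (hi * 2 ^ (w - o)) %% B)); [reflexivity|reflexivity|].
apply: (run_binop (a := lo %/ 2 ^ o + (hi * 2 ^ (w - o)) %% B));
  [reflexivity|exact: modn_small sumB|].
apply: (run_binop (a := rel * C + c)); [reflexivity| |].
  change ((lo %/ 2 ^ o + (hi * 2 ^ (w - o)) %% B) %% 2 ^ v %% B = rel * C + c).
  by rewrite field modn_small.
have C0 : 0 < C by rewrite expn_gt0.
apply: (run_binop (a := rel)); [reflexivity| |].
  change ((rel * C + c) %/ C %% B = rel).
  by rewrite divnMDl // (divn_small cC) addn0 modn_small.
apply: (run_binop (a := c)); [reflexivity| |].
  change ((rel * C + c) %% C %% B = c).
  rewrite modnMDl (modn_small cC) modn_small //.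
  by rewrite (leq_ltn_trans _ fieldB) ?leq_addl.
have tabB : c * b + r + (8 + q + t) < B.
  by apply: ltn_trans szw; rewrite addnC ltn_add2l.
have tab1B : c * b + r < B by apply: leq_ltn_trans tabB; rewrite leq_addr.
apply: (run_binop (a := c * b)); [reflexivity|apply: modn_small|].
  by apply: leq_ltn_trans tab1B; rewrite leq_addr.
apply: (run_binop (a := c * b + r)); [reflexivity|exact: modn_small|].
apply: (run_binop (a := c * b + r + (8 + q + t)));
  [reflexivity|exact: modn_small|].
apply: run_read; [reflexivity|exact: ranker_memory_table|].
have supB : psum xs (k %/ s * s * b) + rel < B.
  by apply: leq_ltn_trans psumB; rewrite isum leq_addr.
apply: (run_binop (a := psum xs (k %/ s * s * b) + rel));
  [reflexivity|exact: modn_small|].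
apply: (run_binop (a := psum xs i)); [reflexivity| |reflexivity].
by rewrite isum in psumB *; apply: modn_small.
Qed.

Lemma prefix_sumE (l n : nat) (x : n.-tuple 'I_l.+1) (i : nat) :
  i <= n -> prefix_sum x i = psum (fun d => nth ord0 x d) i.
Proof.
move=> i_n; rewrite /prefix_sum /psum.
rewrite (big_ord_widen n (fun d => nth ord0 x d : nat)) //.
by apply: eq_bigr => d _; rewrite (tnth_nth ord0).
Qed.

Lemma block_ranker (w l n b s v : nat) :
  0 < b <= n -> 0 < s < 2 ^ w -> s * b * l.+1 ^ b <= 2 ^ v -> v < w ->
  8 < 2 ^ w -> n < 2 ^ w -> n * l < 2 ^ w -> n %/ b * v < 2 ^ w ->
  ranker_size w l n b s v < 2 ^ w ->
  exists D : static_ranker w l n 1 ranker_program 44,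
    forall x, memory_bits D x = w * ranker_size w l n b s v.
Proof.
move=> bn sw vbig vw w8 nw nlw kvw szw.
(* The default [ord0] pads the sequence with zeros, so the bound holds at every index, also beyond
   the last item. *)
have xl (x : n.-tuple 'I_l.+1) d : nth ord0 x d <= l by rewrite -ltnS.
have words x := ranker_memory_words (xl x) bn sw vw nw nlw szw.
have correct (x : n.-tuple 'I_l.+1) i : i <= n -> exists a,
    query w ranker_program
      (ranker_memory w l n b s v (fun d => nth ord0 x d)) 44 i = Some a /\
    additive_approx 1%:Z (prefix_sum x i)%:Z a%:Z.
  move=> i_n; exists (psum (fun d => nth ord0 x d) i); split.
    case/andP: bn sw => b0 _ /andP[s0 _].
    exact: (query_ranker_program (xl x) b0 s0).
  by rewrite prefix_sumE // /additive_approx lexx andbT; lia.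
exists (StaticRanker words correct) => x.
by rewrite /memory_bits; congr (_ * _); apply: size_ranker_memory.
Qed.

(** * Choice of the parameters and integer estimates *)

(** The number of binary digits of a positive [n]: an integer substitute for the logarithm that
    never vanishes. *)
Definition log_len (n : nat) : nat := (trunc_log 2 n).+1.
Definition block_len (l n : nat) : nat :=
  ((trunc_log 2 n)./2 %/ log_len l.+1).+1.
Definition super_len (n : nat) : nat := log_len n ^ 2.
Definition field_width (l n : nat) : nat :=
  log_len (super_len n * block_len l n * l.+1 ^ block_len l n).

Lemma log_len_leq (n : nat) : 0 < n -> log_len n <= n.
Proof.
by move=> n0; apply: leq_trans (trunc_logP (isT : 1 < 2) n0); apply: ltn_expl.
Qed.

Lemma block_len_leq (l n : nat) : block_len l n <= log_len n.
Proof.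
rewrite ltnS (leq_trans (leq_div _ _)) //.
by rewrite -{2}[trunc_log 2 n]odd_double_half -addnn; lia.
Qed.

(** The contents of a block take at least a constant fraction of [log n] bits; against this an
    overhead of O(log log n) bits per field is negligible. *)
Lemma log_len_leq_block (l n : nat) :
  log_len n <= 2 * (block_len l n * log_len l.+1).
Proof.
have := ltn_ceil (trunc_log 2 n)./2 (ltn0Sn (trunc_log 2 l.+1)).
rewrite -/(log_len l.+1) -/(block_len l n) /(log_len n).
have := odd_double_half (trunc_log 2 n); rewrite -addnn.
by case: (odd _) => /=; lia.
Qed.

Lemma half_exp_sqr (n : nat) : 0 < n ->
  2 ^ (trunc_log 2 n)./2 * 2 ^ (trunc_log 2 n)./2 <= n.
Proof.
move=> n0; apply: leq_trans (trunc_logP (isT : 1 < 2) n0).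
rewrite -expnD leq_exp2l // addnn -[leqRHS]odd_double_half.
exact: leq_addl.
Qed.

(** Only [b - 1] items are encoded, and [b - 1] is the quotient rounded down; hence rounding [b] up
    does not enlarge the set of codes. *)
Lemma block_codes_leq (l n : nat) :
  l.+1 ^ (block_len l n).-1 <= 2 ^ (trunc_log 2 n)./2.
Proof.
have lq : l.+1 <= 2 ^ log_len l.+1 by rewrite ltnW // trunc_log_ltn.
set e := _.-1; apply: (@leq_trans ((2 ^ log_len l.+1) ^ e)).
  by have [->//|e0] := posnP e; rewrite leq_exp2r.
by rewrite -expnM leq_exp2l // mulnC leq_trunc_div.
Qed.

(** From [h = 3] on the cube less than doubles at each step; the constant 8 is attained at
    [h = 3]. *)
Lemma cube_leq_exp (h : nat) : h.+1 ^ 3 <= 8 * 2 ^ h.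
Proof.
have [h4|h4] := leqP h 3; first by move: h h4; do 4?case=> //.
elim: h h4 => // h IH; rewrite ltnS leq_eqVlt => /predU1P[<-//|h3].
have step : h.+2 ^ 3 <= 2 * h.+1 ^ 3.
  by rewrite -(subnKC h3); move: (h - 4) => k; rewrite !expnS !expn0; nia.
by rewrite [2 ^ h.+1]expnS; have := IH h3; lia.
Qed.

Lemma log_len_cube (n : nat) : 0 < n ->
  log_len n ^ 3 * 2 ^ (trunc_log 2 n)./2 <= 64 * n.
Proof.
move=> n0; set h := _./2.
have uh : log_len n <= 2 * h.+1.
  rewrite /log_len -[X in X.+1]odd_double_half -/h -addnn.
  by case: (odd _) => /=; lia.
have c3 : log_len n ^ 3 <= 64 * 2 ^ h.
  apply: (@leq_trans ((2 * h.+1) ^ 3)); first by rewrite leq_exp2r.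
  by rewrite expnMn; have := cube_leq_exp h; lia.
apply: (@leq_trans (64 * 2 ^ h * 2 ^ h)); first by rewrite leq_mul2r c3 orbT.
by rewrite -mulnA leq_mul2l half_exp_sqr.
Qed.

(** With [u = log_len n] and [h] about the square root of [n], the constant 12 and the table make at
    most [13 * h * u] words, and [log_len_cube] bounds [h * u ^ 3] by [64 * n]. The superblocks add
    one more [n], and [833 = 13 * 64 + 1]. *)
Lemma overhead_words (l n : nat) : 0 < n ->
  (12 + n %/ super_len n + table_size l (block_len l n)) * log_len n ^ 2
  <= 833 * n.
Proof.
move=> n0.
have := leq_trunc_div n (super_len n).
have := log_len_cube n0.
have : table_size l (block_len l n) <= 2 ^ (trunc_log 2 n)./2 * log_len n.
  by rewrite leq_mul ?block_codes_leq ?block_len_leq.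
have h0 : 0 < 2 ^ (trunc_log 2 n)./2 by rewrite expn_gt0.
have u0 : 0 < log_len n by [].
rewrite /super_len [_ ^ 3]expnS; move: h0 u0.
set h := 2 ^ _; set u := log_len n; set t := table_size _ _.
move=> h0 u0 tl uc nt.
have : 12 + t <= 13 * (h * u) by nia.
rewrite mulnDl mulnDl; set d := _ %/ _ in nt *; set U := u ^ 2 in uc nt *.
move=> tl'.
have : (12 + t) * U <= 13 * (h * u) * U by rewrite leq_mul2r tl' orbT.
by rewrite mulnDl; lia.
Qed.

Lemma field_width_exp (l n : nat) :
  2 ^ field_width l n <= 2 * (log_len n ^ 3 * l.+1 ^ block_len l n).
Proof.
set X := super_len n * block_len l n * l.+1 ^ block_len l n.
rewrite -[field_width l n]/((trunc_log 2 X).+1) expnS leq_mul2l /=.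
apply: (@leq_trans X).
  by apply: trunc_logP; rewrite // !muln_gt0 !expn_gt0.
by rewrite leq_mul2r expnSr leq_mul2l block_len_leq !orbT.
Qed.

(** The 12 words are the header of 8, the two extra packed words, one for the last field, and one
    for the last superblock. *)
Lemma ranker_size_bound (w l n b s v : nat) : v <= w ->
  w * ranker_size w l n b s v
  <= n %/ b * v + w * (12 + n %/ s + table_size l b).
Proof.
move=> vw.
have pk : w * ((n %/ b).+1 * v %/ w) <= n %/ b * v + w.
  by rewrite mulnC (leq_trans (leq_trunc_div _ _)) // mulSn addnC leq_add2l.
have su : w * (n %/ b %/ s) <= w * (n %/ s).
  by rewrite leq_mul2l leq_div2r ?orbT // leq_div.
by rewrite /ranker_size /packed_size /super_size; nia.
Qed.

(** Every quantity that must fit in a word is at most [Y ^ e] with [e <= 15], hence below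
    [Y ^ 16]. *)
Lemma ranker_exists (w l n : nat) :
  0 < l -> 0 < n -> (2 * n * l) ^ 16 <= 2 ^ w ->
  exists D : static_ranker w l n 1 ranker_program 44, forall x,
    memory_bits D x <= n %/ block_len l n * field_width l n
      + w * (12 + n %/ super_len n + table_size l (block_len l n)).
Proof.
move=> l0 n0; set Y := 2 * n * l => Yw.
have Y2 : 1 < Y by rewrite /Y; nia.
have Y0 : 0 < Y by apply: ltnW.
have YX a e : a <= Y ^ e -> e < 16 -> a < 2 ^ w.
  by move=> aY e16; apply: leq_ltn_trans aY (leq_trans _ Yw); rewrite ltn_exp2l.
have nlY : n * l < Y by rewrite /Y; nia.
have nY : n < Y by rewrite /Y; nia.
have lY : l.+1 <= Y by rewrite /Y; nia.
have uY : log_len n <= Y by rewrite (leq_trans (log_len_leq n0)) // ltnW.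
have bY : block_len l n <= Y by rewrite (leq_trans (block_len_leq l n)).
have sY : super_len n <= Y ^ 2 by rewrite leq_exp2r.
have CY : l.+1 ^ (block_len l n).-1 <= Y.
  apply: leq_trans (block_codes_leq l n) (leq_trans _ (ltnW nY)).
  by have := half_exp_sqr n0; have := expn_gt0 2 (trunc_log 2 n)./2; nia.
have bn : block_len l n <= n.
  exact: leq_trans (block_len_leq l n) (log_len_leq n0).
(* One factor [Y] for the 2, three for [log_len n ^ 3], one for [l.+1] and one for the number of
   codes. *)
have vY : 2 ^ field_width l n <= Y ^ 6.
  apply: leq_trans (field_width_exp l n) _.
  have -> : l.+1 ^ block_len l n = l.+1 * l.+1 ^ (block_len l n).-1.
    by rewrite -expnS.
  rewrite (expnD _ 1 5) leq_mul // (expnD _ 3 2) leq_mul //.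
    by rewrite leq_exp2r.
  by rewrite -mulnn leq_mul.
have vw : field_width l n < w.
  by rewrite -(@ltn_exp2l 2) // (YX _ 6).
have vY6 : field_width l n <= Y ^ 6.
  by apply: leq_trans vY; rewrite ltnW // ltn_expl.
have kv : n %/ block_len l n * field_width l n <= Y ^ 7.
  by rewrite (expnD _ 1 6) leq_mul // (leq_trans (leq_div _ _)) // ltnW.
have sz : ranker_size w l n (block_len l n) (super_len n) (field_width l n)
    <= Y ^ 15.
  have tY : table_size l (block_len l n) <= Y ^ 2 by rewrite -mulnn leq_mul.
  have pY : (n %/ block_len l n).+1 * field_width l n %/ w <= Y ^ 7.
    rewrite (leq_trans (leq_div _ _)) // (expnD _ 1 6) leq_mul //.
    by rewrite (leq_ltn_trans (leq_div _ _)).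
  have dY : n %/ block_len l n %/ super_len n <= Y.
    by rewrite (leq_trans (leq_div _ _)) // (leq_trans (leq_div _ _)) // ltnW.
  have le7 e : e <= 7 -> Y ^ e <= Y ^ 7 by move=> e7; rewrite leq_exp2l.
  have e7 : 128 <= Y ^ 7 by rewrite -[128]/(2 ^ 7) leq_exp2r.
  (* The memory has at most a constant times [Y ^ 7] words; eight further factors, each at least 2,
     absorb the constant. *)
  have e15 : 256 * Y ^ 7 <= Y ^ 15.
    by rewrite (expnD _ 8 7) leq_mul2r -[256]/(2 ^ 8) leq_exp2r // Y2 orbT.
  move: tY pY dY (le7 2 isT) (le7 1 isT) e7 e15; rewrite expn1.
  rewrite /ranker_size /packed_size /super_size.
  move: (table_size _ _) (_ %/ w) (_ %/ super_len n) (Y ^ 2) (Y ^ 7) (Y ^ 15).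
  by clear; lia.
have [] := @block_ranker w l n (block_len l n) (super_len n) (field_width l n).
- by rewrite bn.
- by rewrite expn_gt0 /= (YX _ 2).
- by rewrite ltnW // trunc_log_ltn.
- by [].
- by apply: (YX _ 4) => //; apply: (@leq_trans (2 ^ 4)) => //; rewrite leq_exp2r.
- by apply: (YX _ 1) => //; rewrite expn1 ltnW.
- by apply: (YX _ 1) => //; rewrite expn1 ltnW.
- exact: (YX _ 7).
- exact: (YX _ 15).
move=> D DE; exists D => x; rewrite DE ranker_size_bound //.
exact: ltnW.
Qed.

(** * Asymptotic estimates over the reals *)

Local Open Scope classical_set_scope.
Local Open Scope ring_scope.

Lemma ln2_gt0 (R : realType) : 0 < ln 2 :> R.
Proof. by rewrite ln_gt0 // ltr1n. Qed.

Lemma ler_log2 (R : realType) (x y : R) : 0 < x -> x <= y -> log2 x <= log2 y.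
Proof.
move=> x0 xy; rewrite ler_pM2r ?invr_gt0 ?ln2_gt0 // ler_ln // posrE //.
exact: lt_le_trans xy.
Qed.

Lemma log2M (R : realType) (x y : R) : 0 < x -> 0 < y ->
  log2 (x * y) = log2 x + log2 y.
Proof. by move=> x0 y0; rewrite /log2 lnM ?posrE // mulrDl. Qed.

Lemma log2X (R : realType) (x : R) (k : nat) : 0 < x ->
  log2 (x ^+ k) = k%:R * log2 x.
Proof. by move=> x0; rewrite /log2 lnXn // -[ln x *+ k]mulr_natl mulrA. Qed.

Lemma log2_2 (R : realType) : log2 (2 : R) = 1.
Proof. by rewrite /log2 divff // gt_eqF // ln2_gt0. Qed.

Lemma log2_pow2 (R : realType) (k : nat) : log2 (2 ^ k)%:R = k%:R :> R.
Proof. by rewrite natrX log2X // log2_2 mulr1. Qed.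

Lemma trunc_log_le_log2 (R : realType) (n : nat) : (0 < n)%N ->
  (trunc_log 2 n)%:R <= log2 n%:R :> R.
Proof.
move=> n0; rewrite -[leLHS]log2_pow2 ler_log2 ?ltr0n ?expn_gt0 // ler_nat.
exact: trunc_logP.
Qed.

Lemma log2_le_log_len (R : realType) (n : nat) : (0 < n)%N ->
  log2 n%:R <= (log_len n)%:R :> R.
Proof.
move=> n0; rewrite -[leRHS]log2_pow2 ler_log2 ?ltr0n // ler_nat.
by rewrite ltnW // trunc_log_ltn.
Qed.

Lemma log2_ge0 (R : realType) (x : R) : 1 <= x -> 0 <= log2 x.
Proof. by move=> x1; rewrite divr_ge0 ?ln_ge0 ?ler1n. Qed.

Lemma log2_ge1 (R : realType) (l : nat) : (0 < l)%N -> 1 <= log2 l.+1%:R :> R.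
Proof. by move=> l0; rewrite -[leLHS](log2_2 R) ler_log2 // ler_nat. Qed.

(** Twice the logarithm of the square root, combined with [ln y < y]. *)
Lemma log2_le_sqrt (R : realType) (x : R) : 0 < x ->
  log2 x <= 2 / ln 2 * Num.sqrt x.
Proof.
move=> x0; have s0 : 0 < Num.sqrt x by rewrite sqrtr_gt0.
rewrite /log2 -{1}(sqr_sqrtr (ltW x0)) lnXn // mulrAC.
rewrite ler_pM2r ?invr_gt0 ?ln2_gt0 // -[_ *+ 2]mulr_natl ler_pM2l //.
exact/ltW/ln_sublinear.
Qed.

Lemma cvg_inv_sqrt_log_len (R : realType) (A : R) :
  (fun n => A / Num.sqrt (log_len n)%:R) @ \oo --> (0 : R).
Proof.
apply/cvgr0Pnorm_lt => e e0.
(* From [n = 2 ^ k] on, [log_len n] exceeds [k], which exceeds [(A / e) ^ 2]. *)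
pose k := Num.bound ((A / e) ^+ 2).
have kA : (A / e) ^+ 2 < k%:R by apply: archi_boundP; rewrite sqr_ge0.
exists (2 ^ k)%N => //= n /= kn.
have ku : (k < log_len n)%N by rewrite ltnS trunc_log_max.
have s0 : 0 < Num.sqrt (log_len n)%:R :> R by rewrite sqrtr_gt0 ltr0n.
rewrite normrM normfV (gtr0_norm s0) ltr_pdivrMr //.
rewrite mulrC -ltr_pdivrMr // -[e]gtr0_norm // -normf_div -sqrtr_sqr.
rewrite ltr_sqrt ?ltr0n //; apply: lt_le_trans kA _.
by rewrite ler_nat ltnW.
Qed.

(** The logarithm of [(2 * n * l) ^ 16] is exactly the left side of the hypothesis; the factor 2
    accounts for the summand 1. *)
Lemma word_size_exp (R : realType) (w l n : nat) : (0 < l)%N -> (0 < n)%N ->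
  16 * (log2 n%:R + log2 l%:R + 1) <= w%:R :> R ->
  ((2 * n * l) ^ 16 <= 2 ^ w)%N.
Proof.
move=> l0 n0 h.
rewrite -(ler_nat R) leNgt; apply/negP => lt.
have : w%:R < log2 ((2 * n * l) ^ 16)%:R :> R.
  rewrite -[ltLHS]log2_pow2 ltr_pM2r ?invr_gt0 ?ln2_gt0 //.
  by rewrite ltr_ln ?posrE ?ltr0n ?expn_gt0 ?muln_gt0 ?n0 ?l0.
have n0' : 0 < n%:R :> R by rewrite ltr0n.
have l0' : 0 < l%:R :> R by rewrite ltr0n.
rewrite natrX log2X ?natrM ?mulr_gt0 // !log2M ?mulr_gt0 // log2_2; lra.
Qed.

Lemma field_width_le (R : realType) (l n : nat) :
  (field_width l n)%:R <=
  1 + 3 * log2 (log_len n)%:R + (block_len l n)%:R * log2 l.+1%:R :> R.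
Proof.
have u0 : 0 < (log_len n)%:R :> R by rewrite ltr0n.
have l0 : 0 < l.+1%:R :> R by rewrite ltr0n.
rewrite -[leLHS]log2_pow2 -addrA -[X in X + _](log2_2 R) -!log2X //.
rewrite -!log2M ?mulr_gt0 ?exprn_gt0 //.
rewrite ler_log2 ?ltr0n ?expn_gt0 //.
by rewrite -!natrX -!natrM ler_nat field_width_exp.
Qed.

(** The integer bound has factor 2; a second 2 comes from [log_len l.+1 <= log2 l.+1 + 1 <= 2 * log2
    l.+1], as [l] is positive. *)
Lemma log_len_le_block (R : realType) (l n : nat) : (0 < l)%N ->
  (log_len n)%:R <= 4 * ((block_len l n)%:R * log2 l.+1%:R) :> R.
Proof.
move=> l0; have L1 := @log2_ge1 R _ l0.
apply: (@le_trans _ _ (2 * (block_len l n * log_len l.+1))%:R).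
  by rewrite ler_nat log_len_leq_block.
have b0 : 0 <= (block_len l n)%:R :> R by [].
have := @trunc_log_le_log2 R _ (ltn0Sn l).
rewrite !natrM -[(log_len l.+1)%:R]natr1; nra.
Qed.

(** By [log2_le_sqrt] the logarithmic term contributes [4 * 3 * 2 / ln 2], and 4 is at most
    [4 * Num.sqrt u]. *)
Lemma log_overhead_le (R : realType) (u : R) : 1 <= u ->
  4 * (1 + 3 * log2 u) / u <= (4 + 24 / ln 2) / Num.sqrt u.
Proof.
move=> u1; have u0 : 0 < u by lra.
have s0 : 0 < Num.sqrt u by rewrite sqrtr_gt0.
have s1 : 1 <= Num.sqrt u by rewrite -[leLHS]sqrtr1 ler_sqrt ?(ltW u0).
have us : u = Num.sqrt u * Num.sqrt u by rewrite -expr2 sqr_sqrtr // ltW.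
rewrite ler_pdivrMr // [X in _ <= _ * X]us [_ * (Num.sqrt u * _)]mulrA.
rewrite divfK ?gt_eqF //.
have := log2_le_sqrt u0; nra.
Qed.

Lemma memory_overhead (R : realType) (c1 : R) (w l n : nat) :
  (0 < l)%N -> (0 < n)%N ->
  w%:R <= c1 * (log2 n%:R + log2 l%:R + 1) ->
  (n %/ block_len l n * field_width l n
    + w * (12 + n %/ super_len n + table_size l (block_len l n)))%:R
  <= (n%:R * log2 l.+1%:R)
     * (1 + (4 + 24 / ln 2 + 2499 * c1) / Num.sqrt (log_len n)%:R) :> R.
Proof.
move=> l0 n0 wc.
set X := (12 + _ + _)%N.
have XU : X%:R * (log_len n)%:R ^+ 2 <= 833 * n%:R :> R.
  by rewrite -natrX -!natrM ler_nat overhead_words.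
have bu := @log_len_le_block R l n l0.
have fw := @field_width_le R l n.
have L1 := @log2_ge1 R l l0.
have lln : 0 <= log2 l%:R :> R by rewrite log2_ge0 // ler1n.
have llL : log2 l%:R <= log2 l.+1%:R :> R by rewrite ler_log2 ?ltr0n // ler_nat.
have nln : 0 <= log2 n%:R :> R by rewrite log2_ge0 // ler1n.
have nu := @log2_le_log_len R n n0.
have u1 : 1 <= (log_len n)%:R :> R by rewrite ler1n.
have c10 : 0 <= c1.
  have : 0 <= c1 * (log2 n%:R + log2 l%:R + 1) by apply: le_trans wc.
  by rewrite pmulr_lge0 //; lra.
set u : R := (log_len n)%:R in bu fw nu u1 XU *.
set L : R := log2 l.+1%:R in bu fw L1 llL *.
set b : R := (block_len l n)%:R in bu fw *.
have u0 : 0 < u by lra.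
have L0 : 0 < L by lra.
have N0 : 0 < n%:R :> R by rewrite ltr0n.
have b0 : 0 < b by rewrite ltr0n.
(* Each of the three summands is at most [L * u], since [L] and [u] are at least 1. The factor [L]
   lets the final bound be uniform in [l]. *)
have wL : w%:R <= c1 * (3 * L * u).
  by apply: le_trans wc _; rewrite ler_wpM2l //; nra.
(* Here [2499 = 3 * 833]. *)
have wX : w%:R * X%:R <= n%:R * L * (2499 * c1 / u).
  rewrite mulrA ler_pdivlMr // -(ler_pM2r u0).
  have : w%:R * (X%:R * u ^+ 2) <= c1 * (3 * L * u) * (833 * n%:R).
    by rewrite ler_pM // mulr_ge0 // sqr_ge0.
  by rewrite expr2; lra.
have lg0 := log2_ge0 u1.
have kn : (n %/ block_len l n)%:R * b <= n%:R.
  by rewrite -natrM ler_nat leq_trunc_div.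
have k0 : 0 <= (n %/ block_len l n)%:R :> R by [].
have fields : (n %/ block_len l n)%:R * (field_width l n)%:R <=
    n%:R * L * (1 + 4 * (1 + 3 * log2 u) / u).
  set k : R := (n %/ _)%:R in kn k0 *.
  apply: (@le_trans _ _ (k * (1 + 3 * log2 u) + k * (b * L))).
    by rewrite -mulrDr ler_wpM2l.
  have kbL : k * (b * L) <= n%:R * L by rewrite mulrA ler_pM2r.
  (* This turns a cost per block into one relative to [n * L]: each unit per block costs at most the
     fraction [4 / u]. *)
  have ku : k * u <= n%:R * (4 * L).
    apply: (@le_trans _ _ (k * (4 * (b * L)))); first by rewrite ler_wpM2l.
    by lra.
  have : k * (1 + 3 * log2 u) <= n%:R * L * (4 * (1 + 3 * log2 u) / u).
    rewrite mulrA ler_pdivlMr // mulrAC.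
    apply: (@le_trans _ _ (n%:R * (4 * L) * (1 + 3 * log2 u))).
      by rewrite ler_wpM2r //; lra.
    by lra.
  by lra.
have lo := log_overhead_le u1.
(* The rate [1 / u] of the whole words is weakened to that of the fields, so that the two can be
   added. *)
have su : u^-1 <= (Num.sqrt u)^-1.
  have s0 : 0 < Num.sqrt u by rewrite sqrtr_gt0.
  have s1 : 1 <= Num.sqrt u by rewrite -[leLHS]sqrtr1 ler_sqrt ?(ltW u0).
  rewrite lef_pV2 ?posrE // -{2}(sqr_sqrtr (ltW u0)) expr2 ler_peMr //.
  exact: ltW.
have c1u : 2499 * c1 / u <= 2499 * c1 / Num.sqrt u.
  by rewrite ler_wpM2l // mulr_ge0.
rewrite natrD !natrM; apply: le_trans (lerD fields wX) _.
rewrite -mulrDr ler_pM2l; last exact: mulr_gt0 N0 L0.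
rewrite -addrA lerD2l.
by rewrite [leRHS]mulrDl lerD.
Qed.

Theorem theorem1 (R : realType) :
  exists c0 : R, 0 < c0 /\
  forall W : nat -> nat -> nat, theta_word_size c0 W ->
  exists (P : program) (T : nat) (eps : nat -> R),
    eps @ \oo --> (0 : R) /\
    forall l n : nat, (0 < l)%N -> (0 < n)%N ->
    exists D : static_ranker (W l n) l n 1 P T,
      forall x : n.-tuple 'I_l.+1,
        (memory_bits D x)%:R <= (n%:R * log2 (l.+1)%:R) * (1 + eps n).
Proof.
(* The constant 16 is the exponent in [word_size_exp]. *)
exists 16; split=> // W [lower [c1 upper]].
exists ranker_program, 44%N.
exists (fun n => (4 + 24 / ln 2 + 2499 * c1) / Num.sqrt (log_len n)%:R).
split; first exact: cvg_inv_sqrt_log_len.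
move=> l n l0 n0.
have [D DE] := ranker_exists l0 n0 (word_size_exp l0 n0 (lower l n l0 n0)).
exists D => x; apply: le_trans (memory_overhead l0 n0 (upper l n l0 n0)).
by rewrite ler_nat.
Qed.
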